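(* Let $m\ge 2$, let $\mathcal{F}\in\mathbb{R}^{n_1\times\cdots\times n_m}$ be a real tensor of order $m$ (not required to be symmetric), and let $m'=m-1$. Let $F^{sq}$, $h$, $K(w)$, $\mathcal{W}$, the pairing $\langle\cdot,\cdot\rangle$ and the cone $\Sigma_{n_1,\ldots,n_{m'}}$ be as defined in the context. Let $$F_{\max}=\max\{F^{sq}(x^1,\ldots,x^{m'}):\ x^j\in\mathbb{R}^{n_j},\ \|x^1\|=\cdots=\|x^{m'}\|=1\},$$ $$F_{\max}^{\mathrm{sdp}}=\max\{\langle F^{sq},w\rangle:\ w\in\mathcal{W},\ K(w)\succeq 0,\ \langle h,w\rangle=1\},$$ and let $w^*$ be a maximizer of the latter problem. Suppose $F_{\max}=F_{\max}^{\mathrm{sdp}}$. If $F_{\max}\cdot h-F^{sq}$ is a smooth point of the boundary $\partial\Sigma_{n_1,\ldots,n_{m'}}$, then $\operatorname{rank} K(w^* )=1$.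
   Context: The modes of the tensor are labelled so that $n_m=\max_j n_j$. For a positive integer $n$, $[n]=\{1,\ldots,n\}$, and $\|\cdot\|$ is the Euclidean norm. $W\succeq0$ means that the symmetric matrix $W$ is positive semidefinite. The multilinear form of $\mathcal{F}$ is $$F(x^1,\ldots,x^m)=\sum_{1\le i_1\le n_1,\ldots,1\le i_m\le n_m}\mathcal{F}_{i_1,\ldots,i_m}(x^1)_{i_1}\cdots(x^m)_{i_m},\qquad x^j\in\mathbb{R}^{n_j}.$$ Write $F(x^1,\ldots,x^m)=\sum_{j=1}^{n_m}(x^m)_jF_j(x^1,\ldots,x^{m'})$ with each $F_j$ a multilinear form in $(x^1,\ldots,x^{m'})$, where $m'=m-1$, and set $$F^{sq}=\sum_{j=1}^{n_m}F_j(x^1,\ldots,x^{m'})^2,\qquad h=\|x^1\|^2\cdots\|x^{m'}\|^2 .$$ Let $I=[n_1]\times\cdots\times[n_{m'}]$ and $\Omega=I\times I$. For $(\imath,\jmath)\in\Omega$ consider the monomial $$x^{(\imath,\jmath)}:=(x^1)_{\imath_1}(x^1)_{\jmath_1}\cdots(x^{m'})_{\imath_{m'}}(x^{m'})_{\jmath_{m'}}.$$ Let $\mathcal{W}$ be the space of real vectors $w=(w_{\imath,\jmath})_{(\imath,\jmath)\in\Omega}$ such that $w_{\imath,\jmath}$ depends only on the monomial $x^{(\imath,\jmath)}$, i.e. $w_{\imath,\jmath}=w_{\imath',\jmath'}$ whenever $x^{(\imath,\jmath)}=x^{(\imath',\jmath')}$. Let $V$ be the real vector space of forms spanned by the monomials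 $x^{(\imath,\jmath)}$, $(\imath,\jmath)\in\Omega$ (forms that are quadratic in each $x^k$, $k=1,\ldots,m'$). For $p=\sum_{(\imath,\jmath)\in\Omega}p_{\imath,\jmath}\,x^{(\imath,\jmath)}\in V$ and $w\in\mathcal{W}$, define $\langle p,w\rangle=\sum_{(\imath,\jmath)\in\Omega}p_{\imath,\jmath}w_{\imath,\jmath}$; this does not depend on the chosen expansion of $p$. Let $\mathcal{K}(x)=x^1\otimes\cdots\otimes x^{m'}$, viewed as a vector of length $n_1\cdots n_{m'}$ with entries indexed by $I$. $K(w)$ is the symmetric matrix, linear in $w\in\mathcal{W}$, obtained from $\mathcal{K}(x)\mathcal{K}(x)^T$ by replacing each monomial $x^{(\imath,\jmath)}$ by $w_{\imath,\jmath}$; that is, $K(w)$ has rows and columns indexed by $I$ and $K(w)_{\imath,\jmath}=w_{\imath,\jmath}$. $\Sigma_{n_1,\ldots,n_{m'}}$ is the set of all $L=L_1^2+\cdots+L_k^2$ (for some $k$) where each $L_i$ is a real multilinear form in $(x^1,\ldots,x^{m'})$. It is a closed convex cone in $V$, and $\partial\Sigma_{n_1,\ldots,n_{m'}}$ is its boundary in $V$. A point $\sigma$ of this boundary is a smooth point if there is a unique supporting hyperplane of $\Sigma_{n_1,\ldots,n_{m'}}$ through $\sigma$. The semidefinite program defining $F_{\max}^{\mathrm{sdp}}$ attains its optimal value, since its feasible set is nonempty and compact. *)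

(* Defs.v *)
From mathcomp Require Import all_boot all_order all_algebra.
From mathcomp Require Import all_classical all_reals all_analysis.
From mathcomp Require Import ring zify.
Set Implicit Arguments.
Unset Strict Implicit.
Unset Printing Implicit Defensive.
Import Order.TTheory GRing.Theory Num.Theory.
Import numFieldNormedType.Exports.
Local Open Scope classical_set_scope.
Local Open Scope ring_scope.

Definition psd (R : realType) (N : nat) (A : 'M[R]_N) : Prop :=
  A^T = A /\ forall v : 'rV[R]_N, 0 <= (v *m A *m v^T) 0 0.

(* The library norm on ['rV_n] is the maximum norm, hence this definition. *)
Definition enorm (R : realType) (n : nat) (x : 'rV[R]_n) : R :=
  Num.sqrt (\sum_(i < n) x 0 i ^+ 2).

Section Convexity.
Variables (R : realType) (X : Type).
Implicit Types (V C H : set (X -> R)) (s : X -> R).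

(* Topological boundary of [C] relative to [V].  When [V] is finite
   dimensional, the topology of pointwise convergence on [V] is its unique
   Hausdorff vector space topology. *)
Definition boundary_in V C : set (X -> R) :=
  let C' : set (subspace (V : set {ptws X -> R})) := C in
  closure C' `\` interior C'.

Definition linear_on V (l : (X -> R) -> R) : Prop :=
  forall (a : R) (p q : X -> R), V p -> V q ->
    l (fun x => a * p x + q x) = a * l p + l q.

(* [H] is a hyperplane of [V] through [s], with [C] on one side of it. *)
Definition supporting_hyperplane V C s H : Prop :=
  exists (l : (X -> R) -> R) (c : R),
    [/\ linear_on V l,
        exists2 p, V p & l p != 0,
        H = [set p | V p /\ l p = c],
        H s &
        forall p, C p -> c <= l p].

Definition smooth_boundary_point V C s : Prop :=
  boundary_in V C s /\ exists! H, supporting_hyperplane V C s H.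

End Convexity.

Lemma prod_sum_dffun (R : comNzRingType) (m : nat)
    (n : 'I_m -> nat) (f : forall k, 'I_(n k) -> R) :
  \prod_(k < m) \sum_(i < n k) f k i =
  \sum_(i : {dffun forall k : 'I_m, 'I_(n k)}) \prod_(k < m) f k (i k).
Proof.
symmetry; rewrite (reindex (@dffun_of_fprod _ (fun k => 'I_(n k)))); last first.
  exact/onW_bij/dffun_of_fprod_bij.
pose P k : {ffun 'I_(n k) -> R} := [ffun i => f k i].
under eq_bigr do under eq_bigr => k _ do
  rewrite ffunE -[f k _]/(f k _) -(ffunE (f k)) -/(P k).
rewrite (@big_fprod R 0 1 *%R +%R _ (fun k => 'I_(n k)) P).
rewrite -(bigA_distr_big_dep _ (fun k j => untag 0 (P k) j)).
apply: eq_bigr => k _; transitivity (\sum_(i < n k) P k i).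
  by rewrite (@big_tag R 0 +%R _ (fun k => 'I_(n k)) (fun k i => P k i) k).
by apply: eq_bigr => i _; rewrite ffunE.
Qed.

Section Forms.
Variables (R : realType) (m : nat) (n : 'I_m -> nat).

Definition tidx := {dffun forall k : 'I_m, 'I_(n k)}.

Definition vecs := forall k : 'I_m, 'rV[R]_(n k).

Definition tensor := {ffun tidx -> R}.

Definition mlform (A : tensor) (x : vecs) : R :=
  \sum_(i : tidx) A i * \prod_(k < m) x k 0 (i k).

(* The monomial of index (i, j).  Since [R] is infinite, two monomials are
   equal as polynomials iff they are equal as functions; forms are
   represented by the functions they define. *)
Definition monom (o : tidx * tidx) (x : vecs) : R :=
  \prod_(k < m) (x k 0 (o.1 k) * x k 0 (o.2 k)).

Definition combine (c : {ffun tidx * tidx -> R}) (x : vecs) : R :=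
  \sum_(o : tidx * tidx) c o * monom o x.

Definition formV : set (vecs -> R) :=
  [set p | exists c : {ffun tidx * tidx -> R}, p = combine c].

Definition momentW : set (tidx * tidx -> R) :=
  [set w | forall o o', monom o = monom o' -> w o = w o'].

(* An arbitrary expansion of [p] in the monomials; by [pairing_combine] below
   the pairing with [momentW] does not depend on it. *)
Definition expansion (p : vecs -> R) : {ffun tidx * tidx -> R} :=
  xget 0 [set c | p = combine c].

Definition pairing (p : vecs -> R) (w : tidx * tidx -> R) : R :=
  \sum_(o : tidx * tidx) expansion p o * w o.

(* K(w), with [tidx] enumerated by [enum_val]. *)
Definition momentK (w : tidx * tidx -> R) : 'M[R]_#|{: tidx}| :=
  \matrix_(a, b) w (enum_val a, enum_val b).

Definition normprod (x : vecs) : R := \prod_(k < m) enorm (x k) ^+ 2.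

Definition sos_cone : set (vecs -> R) :=
  [set p | exists (k : nat) (L : 'I_k -> tensor),
     p = fun x => \sum_(i < k) mlform (L i) x ^+ 2].

(* [pairing_combine] reads coefficients off a form by polarization in each
   mode: [q (e_i + e_j) - q e_i - q e_j] if [i != j], [q e_i] if [i = j]. *)
Let canon (o : tidx * tidx) : tidx * tidx :=
  ([ffun k => if (o.1 k <= o.2 k)%N then o.1 k else o.2 k],
   [ffun k => if (o.1 k <= o.2 k)%N then o.2 k else o.1 k]).

Let monom_canon o : monom (canon o) = monom o.
Proof.
apply/funext => x; apply: eq_bigr => k _; rewrite /= !ffunE.
by case: ifP => _ //; rewrite mulrC.
Qed.

Let pt (N : nat) (i j : 'I_N) (t : 'I_3) : 'rV[R]_N :=
  \row_a (((t != 2%N :> nat) && (a == i))%:R + ((t != 1%N :> nat) && (a == j))%:R).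

Let wt (N : nat) (i j : 'I_N) (t : 'I_3) : R :=
  if i == j then (t == 1%N :> nat)%:R else (-1) ^+ (t != 0%N :> nat).

Let extract1 (N : nat) (i j a b : 'I_N) :
  \sum_(t < 3) wt i j t * (pt i j t 0 a * pt i j t 0 b) =
  (((a == i) && (b == j)) || ((a == j) && (b == i)))%:R.
Proof.
rewrite !big_ord_recl big_ord0 /wt /pt !mxE /=.
have [<-{j}|ij] := eqVneq i j; last first.
  case: (eqVneq a i) => [->|ai]; case: (eqVneq b j) => [->|bj];
    rewrite ?(eq_sym j i) ?(negbTE ij) ?eqxx /=;
    case: (a == j); case: (b == i); rewrite /= ?expr0 ?expr1; ring.
by case: (a == i); case: (b == i); rewrite /=; ring.
Qed.

Let canon_pair (N : nat) (i j a b : 'I_N) :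
  (((a == i) && (b == j)) || ((a == j) && (b == i))) =
  (((if (i <= j)%N then i else j) == (if (a <= b)%N then a else b)) &&
   ((if (i <= j)%N then j else i) == (if (a <= b)%N then b else a))).
Proof.
rewrite -!val_eqE /=; case: (leqP i j) => ij; case: (leqP a b) => ab /=;
  apply/idP/idP => H; lia.
Qed.

Let extract (o : tidx * tidx) (p : vecs -> R) : R :=
  \sum_(t : {ffun 'I_m -> 'I_3})
     (\prod_(k < m) wt (o.1 k) (o.2 k) (t k)) *
       p (fun k => pt (o.1 k) (o.2 k) (t k)).

Let extract_monom o o' : extract o (monom o') = (canon o == canon o')%:R.
Proof.
rewrite /extract /monom; under eq_bigr do rewrite -big_split /=.
rewrite -(bigA_distr_bigA (fun k t => wt (o.1 k) (o.2 k) t *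
  (pt (o.1 k) (o.2 k) t 0 (o'.1 k) * pt (o.1 k) (o.2 k) t 0 (o'.2 k)))).
under eq_bigr do rewrite extract1 canon_pair.
have [e|ne] := eqVneq (canon o) (canon o').
  rewrite big1 // => k _.
  move: (congr1 (fun u : tidx * tidx => u.1 k) e)
    (congr1 (fun u : tidx * tidx => u.2 k) e) => /=.
  by rewrite !ffunE => -> ->; rewrite !eqxx.
pose B k := (canon o).1 k == (canon o').1 k.
pose B' k := (canon o).2 k == (canon o').2 k.
have [k kB] : exists k, ~~ (B k && B' k).
  apply/existsP; apply: contraNT ne; rewrite negb_exists => /forallP H.
  by apply/eqP; congr pair; apply/ffunP => k; have := H k;
    rewrite negbK => /andP[/eqP ? /eqP].
by move: kB; rewrite /B /B' /= !ffunE (bigD1 k) //= => /negbTE ->; rewrite mul0r.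
Qed.

Let extract_combine c o :
  extract o (combine c) = \sum_(o' | canon o' == canon o) c o'.
Proof.
rewrite /extract /combine; under eq_bigr do rewrite big_distrr /=.
rewrite exchange_big [RHS]big_mkcond /=; apply: eq_bigr => o' _.
transitivity (c o' * extract o (monom o')).
  by rewrite /extract big_distrr; apply: eq_bigr => t _; rewrite mulrCA.
by rewrite extract_monom eq_sym; case: eqP; rewrite ?mulr1 ?mulr0.
Qed.

Lemma pairing_combine c w : momentW w ->
  pairing (combine c) w = \sum_(o : tidx * tidx) c o * w o.
Proof.
move=> Ww; pose S (d : {ffun tidx * tidx -> R}) := \sum_o d o * w o.
have SE d : S d = \sum_o \sum_(o' | canon o' == o) d o' * w o'.
  by rewrite /S (partition_big canon xpredT).
have canonK o : canon (canon o) = canon o.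
  congr pair; apply/ffunP => k; rewrite /= !ffunE /=;
    case: (leqP (o.1 k) (o.2 k)) => ?; case: leqP => ? //;
    apply/val_inj => /=; lia.
have SE' d : S d = \sum_(o | canon o == o) w o * extract o (combine d).
  rewrite SE [RHS]big_mkcond; apply: eq_bigr => o _ /=.
  case: eqP => oE; last first.
    by rewrite big_pred0 // => o'; apply/eqP => E; apply: oE; rewrite -E.
  rewrite extract_combine big_distrr oE /=; apply: eq_bigr => o' /eqP <-.
  by rewrite mulrC; congr (_ * _); apply: Ww; rewrite monom_canon.
have cE : combine c = combine (expansion (combine c)).
  exact: (xgetPex 0 (ex_intro [set d | combine c = combine d] c erefl)).
by rewrite -[LHS]/(S _) -[RHS]/(S c) !SE' -cE.
Qed.

Lemma normprod_formV : formV normprod.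
Proof.
exists [ffun o => (o.1 == o.2)%:R]; apply/funext => x.
rewrite /normprod /combine.
transitivity (\prod_(k < m) \sum_(i < n k) x k 0 i ^+ 2).
  apply: eq_bigr => k _; rewrite sqr_sqrtr // sumr_ge0 // => i _.
  exact: sqr_ge0.
rewrite (prod_sum_dffun (fun k i => x k 0 i ^+ 2)).
transitivity (\sum_(i : tidx) \sum_(j : tidx) (i == j)%:R * monom (i, j) x).
  apply: eq_bigr => i _; rewrite (bigD1 i) //= eqxx mul1r.
  rewrite [X in _ + X]big1 ?addr0 // => j ji; rewrite eq_sym (negbTE ji).
  by rewrite mul0r.
by rewrite pair_bigA; apply: eq_bigr => -[i j] _; rewrite ffunE.
Qed.

Lemma sqr_mlform (A : tensor) x :
  mlform A x ^+ 2 = combine [ffun o => A o.1 * A o.2] x.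
Proof.
rewrite expr2 /mlform big_distrlr pair_bigA; apply: eq_bigr => -[i j] _ /=.
by rewrite ffunE /monom big_split mulrACA.
Qed.

End Forms.

(* The order of the tensor is [m'.+1], and its last mode is [ord_max]. *)
Section Tensor.
Variables (R : realType) (m' : nat) (n : 'I_m'.+1 -> nat).

Definition first_modes (k : 'I_m') : nat := n (widen_ord (leqnSn m') k).

Variable F : tensor R n.

(* The form F_j, see [mlform_last] below. *)
Definition slice (j : 'I_(n ord_max)) (x : vecs R first_modes) : R :=
  \sum_(i : tidx n | i ord_max == j)
     F i * \prod_(k < m') x k 0 (i (widen_ord (leqnSn m') k)).

Definition Fsq (x : vecs R first_modes) : R :=
  \sum_(j < n ord_max) slice j x ^+ 2.

(* When all the mode sizes are positive, the sets in [Fmax] and [Fmax_sdp] are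
   nonempty and compact, so that [sup] is their maximum. *)
Definition Fmax : R :=
  sup [set Fsq x | x in [set x | forall k, enorm (x k) = 1]].

Definition sdp_feasible : set (tidx first_modes * tidx first_modes -> R) :=
  [set w | [/\ momentW w, psd (momentK w) &
               pairing (@normprod R _ first_modes) w = 1]].

Definition Fmax_sdp : R := sup [set pairing Fsq w | w in sdp_feasible].

Definition sdp_maximizer (w : tidx first_modes * tidx first_modes -> R) : Prop :=
  sdp_feasible w /\ forall v, sdp_feasible v -> pairing Fsq v <= pairing Fsq w.

Lemma mlform_last (x : vecs R n) :
  mlform F x = \sum_(j < n ord_max)
    x ord_max 0 j * slice j (fun k => x (widen_ord (leqnSn m') k)).
Proof.
rewrite /mlform (partition_big (fun i : tidx n => i ord_max) xpredT) //=.
apply: eq_bigr => j _; rewrite /slice big_distrr /=.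
apply: eq_bigr => i /eqP <-; rewrite big_ord_recr /=.
by rewrite mulrA mulrC.
Qed.

Lemma Fsq_formV : formV Fsq.
Proof.
pose A j : tensor R first_modes := [ffun u : tidx first_modes =>
  \sum_(i : tidx n | (i ord_max == j) &&
     [forall k, i (widen_ord (leqnSn m') k) == u k]) F i].
have sliceE j x : slice j x = mlform (A j) x.
  rewrite /slice /mlform (partition_big (fun i : tidx n =>
    [ffun k => i (widen_ord (leqnSn m') k)] : tidx first_modes) xpredT) //=.
  apply: eq_bigr => u _; rewrite ffunE big_distrl /=.
  have uE (i : tidx n) :
      ([ffun k => i (widen_ord (leqnSn m') k)] == u :> tidx first_modes) =
      [forall k, i (widen_ord (leqnSn m') k) == u k].
    apply/eqP/forallP => [<- k|H]; first by rewrite ffunE eqxx.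
    by apply/ffunP => k; rewrite ffunE (eqP (H k)).
  rewrite (eq_bigl _ _ (fun i => congr1 (andb _) (uE i))).
  apply: eq_bigr => i /andP[_ /forallP H]; congr (_ * _).
  by apply: eq_bigr => k _; rewrite (eqP (H k)).
exists [ffun o => \sum_j A j o.1 * A j o.2]; apply/funext => x.
rewrite /Fsq /combine; under eq_bigr do rewrite sliceE sqr_mlform.
rewrite exchange_big; apply: eq_bigr => o _ /=.
by rewrite ffunE big_distrl; apply: eq_bigr => j _; rewrite ffunE.
Qed.

End Tensor.

(* Main.v *)
Require Import Defs.
From mathcomp Require Import all_boot all_order all_algebra.
From mathcomp Require Import all_classical all_reals all_analysis.
From mathcomp Require Import ring.
Set Implicit Arguments.
Unset Strict Implicit.
Unset Printing Implicit Defensive.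
Import Order.TTheory GRing.Theory Num.Theory.
Import numFieldNormedType.Exports.
Local Open Scope classical_set_scope.
Local Open Scope ring_scope.

(** Let [s = Fmax h - F^sq], let [w'] be the given maximizer, and let [u] be a
    point of the product of spheres at which [F^sq] attains [Fmax].  The
    functionals [<., w'>] and evaluation at [u] are both nonnegative on the
    cone of sums of squares, vanish at [s] and take the value 1 at [h], so each
    of them defines a supporting hyperplane at [s].  By smoothness these
    hyperplanes coincide, and by the common normalization at [h] the
    functionals are equal on V.  Evaluating them at the monomials shows that
    K(w') is the moment matrix of [u], which is K(u) K(u)^T. *)

Section Smooth.
Variables (R : realType) (X : Type).
Implicit Types (V C : set (X -> R)) (s h : X -> R) (l : (X -> R) -> R).

Lemma supporting_hyperplane_ker V C s h l :
  linear_on V l -> V s -> V h -> l s = 0 -> l h = 1 ->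
  (forall p, C p -> 0 <= l p) ->
  supporting_hyperplane V C s [set p | V p /\ l p = 0].
Proof.
move=> ll Vs Vh ls lh lC; exists l, 0; split=> //.
by exists h => //; rewrite lh oner_neq0.
Qed.

(** The zero sets of [l] and [l'] in [V] both support [C] at [s], so smoothness makes them equal.
    Two functionals with the same kernel are proportional, and their common value 1 at [h] fixes the
    factor. *)
Lemma smooth_boundary_point_unique V C s h l l' :
  (forall (a : R) p q, V p -> V q -> V (fun x => a * p x + q x)) ->
  smooth_boundary_point V C s -> V s -> V h ->
  linear_on V l -> l s = 0 -> l h = 1 -> (forall p, C p -> 0 <= l p) ->
  linear_on V l' -> l' s = 0 -> l' h = 1 -> (forall p, C p -> 0 <= l' p) ->
  forall p, V p -> l p = l' p.
Proof.
move=> VD [_ [H [_ Huniq]]] Vs Vh ll ls lh lC ll' ls' lh' lC' p Vp.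
have e := Huniq _ (supporting_hyperplane_ker ll Vs Vh ls lh lC).
have e' := Huniq _ (supporting_hyperplane_ker ll' Vs Vh ls' lh' lC').
(* This is the projection of [p] along [h] onto the kernel of [l']. As [q] then lies in the kernel
   of [l] too, [l p = l' p]. *)
pose q x := - l' p * h x + p x.
have Vq : V q by exact: VD.
have : [set p | V p /\ l' p = 0] q.
  by split=> //; rewrite ll' // lh' mulr1 addNr.
rewrite -e' e => -[_]; rewrite ll // lh mulr1 => /eqP.
by rewrite addrC subr_eq0 => /eqP.
Qed.

End Smooth.

Lemma ubound_sup (R : realType) (A : set R) (a : R) :
  A a -> ubound A a -> sup A = a.
Proof.
move=> Aa ubA; apply/le_anti/andP; split.
  by apply: ge_sup => //; exists a.
by apply: (ub_le_sup _ Aa); exists a.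
Qed.

Section Forms.
Variables (R : realType) (m : nat) (n : 'I_m -> nat).
Implicit Types (p : vecs R n -> R) (w : tidx n * tidx n -> R).

Lemma combineD (a : R) (c d : {ffun tidx n * tidx n -> R}) x :
  a * combine c x + combine d x = combine [ffun o => a * c o + d o] x.
Proof.
rewrite /combine big_distrr -big_split; apply: eq_bigr => o _ /=.
by rewrite ffunE mulrDl mulrA.
Qed.

Lemma formV_linear (a : R) p q :
  formV p -> formV q -> formV (fun x => a * p x + q x).
Proof.
move=> [c ->] [d ->]; exists [ffun o => a * c o + d o].
by apply/funext => x; rewrite combineD.
Qed.

Lemma pairing_linear w :
  momentW w -> linear_on (@formV R m n) (fun p => pairing p w).
Proof.
move=> Ww a _ _ [c ->] [d ->].
rewrite (funext (combineD a c d)) !pairing_combine // big_distrr -big_split /=.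
by apply: eq_bigr => o _; rewrite ffunE mulrDl mulrA.
Qed.

Lemma monomE (o : tidx n * tidx n) :
  monom (R := R) o = combine [ffun o' => (o' == o)%:R].
Proof.
apply/funext => x; rewrite /combine (bigD1 o) //= ffunE eqxx mul1r.
by rewrite big1 ?addr0 // => o' /negbTE; rewrite ffunE => ->; rewrite mul0r.
Qed.

Lemma pairing_monom w o : momentW w -> pairing (monom (R := R) o) w = w o.
Proof.
move=> Ww; rewrite monomE pairing_combine // (bigD1 o) //= ffunE eqxx mul1r.
by rewrite big1 ?addr0 // => o' /negbTE; rewrite ffunE => ->; rewrite mul0r.
Qed.

(** Pairing the square of one multilinear form with [w] gives the quadratic form of K(w) at the
    coefficient vector of that form. *)
Lemma pairing_sum_sqr_ge0 w k (L : 'I_k -> tensor R n) :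
  momentW w -> psd (momentK w) ->
  0 <= pairing (fun x => \sum_(i < k) mlform (L i) x ^+ 2) w.
Proof.
move=> Ww [_ psdK].
have -> : (fun x => \sum_(i < k) mlform (L i) x ^+ 2) =
    combine [ffun o => \sum_(i < k) L i o.1 * L i o.2].
  apply/funext => x; under eq_bigr do rewrite sqr_mlform.
  rewrite exchange_big; apply: eq_bigr => o _ /=.
  by rewrite ffunE big_distrl; apply: eq_bigr => i _; rewrite ffunE.
rewrite pairing_combine //; under eq_bigr do rewrite ffunE big_distrl.
rewrite exchange_big sumr_ge0 // => i _ /=.
have := psdK (\row_a L i (enum_val a)).
congr (0 <= _); rewrite -mulmxA mxE.
transitivity (\sum_a \sum_b L i a * L i b * w (a, b)); last first.
  by rewrite pair_bigA; apply: eq_bigr => -[].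
rewrite (reindex (@enum_val _ {: tidx n})) /=; last first.
  exact: (onW_bij _ (@enum_val_bij (tidx n))).
apply: eq_bigr => a _; rewrite !mxE big_distrr.
rewrite (reindex (@enum_val _ {: tidx n})) /=; last first.
  exact: (onW_bij _ (@enum_val_bij (tidx n))).
by apply: eq_bigr => b _; rewrite !mxE -mulrA [w _ * _]mulrC.
Qed.

Lemma sos_cone_pairing_ge0 w p :
  momentW w -> psd (momentK w) -> sos_cone p -> 0 <= pairing p w.
Proof. by move=> Ww Kw [k [L ->]]; exact: pairing_sum_sqr_ge0. Qed.

Lemma sos_cone_ge0 p x : sos_cone p -> 0 <= p x.
Proof. by move=> [k [L ->]]; apply: sumr_ge0 => i _; exact: sqr_ge0. Qed.

(** Each monomial splits into a factor for its row index and one for its column index, so K(w) is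
    the outer product of the vector of entries of the tensor product of the [x k] with itself. The
    nonzero entry excludes rank 0. *)
Lemma rank_momentK_monom w (x : vecs R n) :
  (exists o, w o != 0) -> (forall o, w o = monom o x) ->
  \rank (momentK w) = 1%N.
Proof.
move=> [[a b] wab] wE.
pose v : 'rV[R]_#|{: tidx n}| :=
  \row_a \prod_(k < m) x k 0 ((enum_val a : tidx n) k).
have KE : momentK w = v^T *m v.
  by apply/matrixP => i j; rewrite !mxE big_ord1 !mxE wE /monom big_split.
apply/eqP; rewrite eqn_leq {1}KE mulmx_max_rank lt0n mxrank_eq0 /=.
apply: contraNneq wab => /matrixP/(_ (enum_rank a) (enum_rank b)).
by rewrite !mxE !enum_rankK => ->.
Qed.

(* The product of spheres is viewed inside the space of functions on pairs
   (mode, index), where Tychonoff's theorem applies. *)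
Lemma formV_max_spheres p : formV p -> (forall k, 0 < n k)%N ->
  exists2 u : vecs R n, (forall k, enorm (u k) = 1) &
    forall x : vecs R n, (forall k, enorm (x k) = 1) -> p x <= p u.
Proof.
move=> [c ->] n_gt0; pose J := {k : 'I_m & 'I_(n k)}.
pose E : topologicalType := {ptws J -> R}.
pose vec (f : E) : vecs R n := fun k => \row_i f (existT _ k i).
(* The product of spheres is cut out of the compact cube [A] by the closed conditions collected in
   [B]. *)
pose A : set E := [set f | forall j, `[-1, 1]%classic (f j)].
pose sq k (f : E) : R := \sum_(i < n k) f (existT _ k i) ^+ 2.
pose B : set E := \bigcap_(k in [set: 'I_m]) (sq k @^-1` [set 1]).
have coord_cont j : continuous (fun f : E => f j).
  exact: (@proj_continuous J (fun=> R) j).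
have sqE k f : sq k f = enorm (vec f k) ^+ 2.
  rewrite sqr_sqrtr ?sumr_ge0 // => [|i _]; last exact: sqr_ge0.
  by apply: eq_bigr => i _; rewrite mxE.
have enorm_ge0 k (x : vecs R n) : 0 <= enorm (x k) by exact: sqrtr_ge0.
have cptAB : compact (A `&` B).
  apply: compact_closedI.
    apply: (@tychonoff J (fun=> R) (fun=> `[-1, 1]%classic)) => j.
    exact: segment_compact.
  apply: closed_bigI => k _.
  apply: closed_comp => [f0 _|]; last exact: closed_eq.
  apply: continuous_big; first exact: add_continuous.
  by move=> i _ f; exact: (cvgM (coord_cont _ f) (coord_cont _ f)).
have ABP f : (A `&` B) f <-> forall k, enorm (vec f k) = 1.
  split=> [[_ Bf] k|Hf].
    have := Bf k I; rewrite /= sqE => /eqP.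
    by rewrite sqrp_eq1 ?enorm_ge0 // => /eqP.
  have sq1 k : sq k f = 1 by rewrite sqE Hf expr1n.
  split=> [[k i]|k _ /=]; last exact: sq1.
  (* The square of a coordinate is one term of a sum of squares equal to 1. *)
  rewrite /= in_itv /= -ler_norml -(@expr_le1 _ 2) // real_normK ?num_real //.
  rewrite -(sq1 k) /sq (bigD1 i) //= lerDl sumr_ge0 // => a _.
  exact: sqr_ge0.
have monom_cont o : continuous (fun f => monom o (vec f)).
  have -> : (fun f => monom o (vec f)) = fun f =>
      \prod_(k < m) (f (existT _ k (o.1 k)) * f (existT _ k (o.2 k))).
    by apply/funext => f; apply: eq_bigr => k _; rewrite !mxE.
  apply: continuous_big; first exact: mul_continuous.
  by move=> k _ f; exact: (cvgM (coord_cont _ f) (coord_cont _ f)).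
pose g f := combine c (vec f).
have gcont : continuous g.
  apply: continuous_big; first exact: add_continuous.
  by move=> o _ f; exact: (cvgM (cvg_cst (c o)) (monom_cont o f)).
pose flat (x : vecs R n) : E := fun j => x (tag j) 0 (tagged j).
have flatK x : vec (flat x) = x.
  by apply/functional_extensionality_dep => k; apply/rowP => i; rewrite mxE.
have AB0 : A `&` B !=set0.
  (* The first standard basis vector in each mode gives a point of the product of spheres. *)
  exists (flat (fun k => delta_mx 0 (Ordinal (n_gt0 k)))); apply/ABP => k.
  rewrite flatK /enorm (bigD1 (Ordinal (n_gt0 k))) //= mxE !eqxx expr1n.
  rewrite big1 ?addr0 ?sqrtr1 // => i /negbTE ik.
  by rewrite mxE ik andbF expr0n.
have [f ABf fmax] := compact_EVT_max AB0 cptAB (continuous_subspaceT gcont).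
exists (vec f); first by apply/ABP; rewrite -in_setE.
move=> x x1; rewrite -[x]flatK; apply: fmax.
by rewrite inE; apply/ABP; rewrite flatK.
Qed.

End Forms.

Theorem theorem2p5 (R : realType) (m' : nat) (n : 'I_m'.+1 -> nat)
    (F : tensor R n)
    (w : tidx (first_modes n) * tidx (first_modes n) -> R) :
  (2 <= m'.+1)%N ->
  (forall j, 0 < n j)%N ->
  (forall j, n j <= n ord_max)%N ->
  sdp_maximizer F w ->
  Fmax F = Fmax_sdp F ->
  smooth_boundary_point (@formV R m' (first_modes n))
    (@sos_cone R m' (first_modes n))
    (fun x => Fmax F * normprod x - Fsq F x) ->
  \rank (momentK w) = 1%N.
Proof.
move=> _ n_gt0 _ [[Ww Kw hw] wmax] FmaxE smooth.
have Vh := @normprod_formV R m' (first_modes n).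
have VF := Fsq_formV F.
have [|u u1 umax] := formV_max_spheres VF; first by move=> k; exact: n_gt0.
have FmaxuE : Fmax F = Fsq F u.
  by apply: ubound_sup => [|_ [x /umax Hx <-]]; first by exists u.
have FmaxwE : Fmax F = pairing (Fsq F) w.
  rewrite FmaxE; apply: ubound_sup => [|_ [v /wmax Hv <-]] //.
  by exists w.
have hu : normprod u = 1 by apply: big1 => k _; rewrite u1 expr1n.
(* Membership in [formV] and linearity are available for the shape [a * p + q] only, so [- Fsq] is
   written as [-2 * Fsq + Fsq]. *)
pose s' x := Fmax F * normprod x + (-2 * Fsq F x + Fsq F x).
have sE : (fun x => Fmax F * normprod x - Fsq F x) = s'.
  by apply/funext => x; rewrite /s'; ring.
have VN : formV (fun x => -2 * Fsq F x + Fsq F x) by exact: formV_linear.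
have lsE (l : (vecs R (first_modes n) -> R) -> R) :
    linear_on (@formV R m' (first_modes n)) l -> l (@normprod R _ _) = 1 ->
    l (Fsq F) = Fmax F -> l s' = 0.
  by move=> ll lh lF; rewrite !ll // lh lF; ring.
rewrite sE in smooth.
have evl : linear_on (@formV R m' (first_modes n)) (fun p => p u) by [].
have eq_eval := smooth_boundary_point_unique (@formV_linear _ _ _) smooth
  (formV_linear _ Vh VN) Vh (pairing_linear Ww) (lsE _ (pairing_linear Ww) hw
  (esym FmaxwE)) hw (fun p => sos_cone_pairing_ge0 Ww Kw) evl
  (lsE _ evl hu (esym FmaxuE)) hu (fun p => @sos_cone_ge0 _ _ _ p u).
apply: (@rank_momentK_monom _ _ _ w u).
  (* If [w] vanished identically, its pairing with h would be 0 instead of 1. *)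
  apply: contrapT => w0; have := hw; rewrite /pairing big1 => [/esym/eqP|o _].
    by rewrite oner_eq0.
  have [->|wo] := eqVneq (w o) 0; first by rewrite mulr0.
  by case: w0; exists o.
move=> o; rewrite -(pairing_monom o Ww); apply: eq_eval.
by rewrite monomE; exists [ffun o' => (o' == o)%:R].
Qed.
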